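(* Let $G$ be a countable discrete group, let $A$ be a countable amenable group on which $G$ acts by automorphisms, and consider the semi-direct product $G\ltimes A$. Then there exists a non-degenerate probability measure $\mu$ on $G\ltimes A$ such that the action of $G\ltimes A$ on $A$ is $\mu$-Liouville.
   Context: Let $\alpha:G\to\mathrm{Aut}(A)$ be the action of $G$ on $A$ by automorphisms. The semi-direct product $G\ltimes A$ is the set of pairs $(g,a)$, $g\in G$, $a\in A$, with multiplication $(g,a)(h,b)=(gh,\,a\,\alpha_g(b))$, and it acts on the set $A$ by $(g,a)\cdot b=a\,\alpha_g(b)$ (so $A$ acts on itself by translation and $G$ acts by automorphisms). Let a discrete group $H$ act on a countable set $X$ and let $\mu$ be a probability measure on $H$. The measure $\mu$ is non-degenerate if its support $\{h:\mu(h)>0\}$ generates $H$ as a group. The transition matrix on $X$ induced by $\mu$ is $P_\mu(x,y)=\sum_{h\in H}\mathbf{1}_{\{h\cdot x=y\}}\mu(h)$. A function $f:X\to\mathbb{R}$ is $P_\mu$-harmonic if $f(x)=\sum_{y\in X}f(y)P_\mu(x,y)$ for all $x\in X$. The action of $H$ on $X$ is $\mu$-Liouville if all bounded $P_\mu$-harmonic functions on $X$ are constant. *)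

(* Defs.v *)
From HB Require Import structures.
From mathcomp Require Import all_boot all_order all_algebra.
From mathcomp Require Import mathcomp_extra boolp classical_sets functions.
From mathcomp Require Import cardinality reals ereal numfun esum.

Set Implicit Arguments.
Unset Strict Implicit.
Unset Printing Implicit Defensive.

Import Order.TTheory GRing.Theory Num.Theory.

Local Open Scope classical_set_scope.
Local Open Scope ring_scope.

Record grpAction (H : groupType) (X : Type) := GrpAction {
  gact :> H -> X -> X;
  gact1 : forall x, gact 1%g x = x;
  gactM : forall g h x, gact (g * h)%g x = gact g (gact h x) }.

(* An action by multiplicative maps is the same thing as a homomorphism
   G -> Aut(A): each [gact g] is bijective, with inverse [gact g^-1]. *)
Record autAction (G A : groupType) := AutAction {
  aut_act :> grpAction G A;
  aut_actM : forall g a b, aut_act g (a * b)%g = (aut_act g a * aut_act g b)%g }.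

(* The parameter [al] is recorded in the type so that the group structure,
   which depends on it, can be inferred. *)
Definition semidirect (G A : groupType) (al : autAction G A) : Type :=
  (G * A)%type.

Section Semidirect.
Variables (G A : groupType) (al : autAction G A).

HB.instance Definition _ := Choice.copy (semidirect al) (G * A)%type.

Definition sd_one : semidirect al := (1%g, 1%g).
Definition sd_mul (x y : semidirect al) : semidirect al :=
  ((x.1 * y.1)%g, (x.2 * al x.1 y.2)%g).
Definition sd_inv (x : semidirect al) : semidirect al :=
  (x.1^-1%g, al x.1^-1%g x.2^-1%g).

Lemma aut_act1 g : al g 1%g = 1%g.
Proof.
by apply: (@mulgI _ (al g 1%g)); rewrite -aut_actM !mulg1.
Qed.

Lemma sd_mulA : associative sd_mul.
Proof.
by move=> x y z; rewrite /sd_mul /= !mulgA aut_actM gactM mulgA.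
Qed.

Lemma sd_mul1 : left_id sd_one sd_mul.
Proof. by case=> g a; rewrite /sd_mul /= !mul1g gact1. Qed.

Lemma sd_mulr1 : right_id sd_one sd_mul.
Proof. by case=> g a; rewrite /sd_mul /= aut_act1 !mulg1. Qed.

Lemma sd_mulV : left_inverse sd_one sd_inv sd_mul.
Proof. by case=> g a; rewrite /sd_mul /= -aut_actM !mulVg aut_act1. Qed.

Lemma sd_mulrV : right_inverse sd_one sd_inv sd_mul.
Proof.
by case=> g a; rewrite /sd_mul /= -gactM !mulgV gact1 mulgV.
Qed.

HB.instance Definition _ := isGroup.Build (semidirect al)
  sd_mulA sd_mul1 sd_mulr1 sd_mulV sd_mulrV.

Definition sd_act (x : semidirect al) (b : A) : A := (x.2 * al x.1 b)%g.

Lemma sd_act1 b : sd_act 1%g b = b.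
Proof. by rewrite /sd_act /= gact1 mul1g. Qed.

Lemma sd_actM (x y : semidirect al) b :
  sd_act (x * y)%g b = sd_act x (sd_act y b).
Proof. by rewrite /sd_act /= gactM aut_actM mulgA. Qed.

Definition semidirect_action : grpAction (semidirect al) A :=
  GrpAction sd_act1 sd_actM.

End Semidirect.

Definition bounded_real (R : realType) (X : Type) (f : X -> R) : Prop :=
  exists M : R, forall x, `|f x| <= M.

(* Left-invariant mean on the bounded real functions on A; the values of [m]
   at unbounded functions are irrelevant. *)
Definition invariant_mean (R : realType) (A : groupType)
    (m : (A -> R) -> R) : Prop :=
  [/\ forall (c : R) (f g : A -> R), bounded_real f -> bounded_real g ->
        m (fun a => c * f a + g a) = c * m f + m g,
      forall f : A -> R, bounded_real f -> (forall a, 0 <= f a) -> 0 <= m f,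
      m (fun=> 1) = 1
    & forall (b : A) (f : A -> R), bounded_real f ->
        m (fun a => f (b * a)%g) = m f].

Definition amenable (R : realType) (A : groupType) : Prop :=
  exists m : (A -> R) -> R, invariant_mean m.

(* Probability measures on a countable discrete group are given by their
   mass functions. *)
Definition prob_mass (R : realType) (H : choiceType) (mu : H -> R) : Prop :=
  (forall h, 0 <= mu h) /\ (\esum_(h in [set: H]) (mu h)%:E = 1)%E.

Definition generates (H : groupType) (S : set H) : Prop :=
  smallest (fun K : set H => group_closed (mem K)) S = [set: H].

Definition nondegenerate_mass (R : realType) (H : groupType) (mu : H -> R) : Prop :=
  generates [set h | 0 < mu h].

Section Liouville.
Variables (R : realType) (H : groupType) (X : choiceType).
Variables (act : grpAction H X) (mu : H -> R).

Definition transition (x y : X) : \bar R :=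
  (\esum_(h in [set: H]) ((act h x == y)%:R * mu h)%:E)%E.

(* [\esum] is meant for nonnegative families, so the sum of the signed family
   f(y)P(x,y) is required to converge absolutely and is the difference of the
   sums of its positive and negative parts.  For bounded f and a probability
   measure mu the convergence is automatic. *)
Definition mu_harmonic (f : X -> R) : Prop :=
  forall x, let u := (fun y => (f y)%:E * transition x y)%E in
    summable [set: X] u /\
    ((f x)%:E =
      \esum_(y in [set: X]) (u^\+ y) - \esum_(y in [set: X]) (u^\- y))%E.

Definition mu_liouville : Prop :=
  forall f : X -> R, bounded_real f -> mu_harmonic f ->
    exists c : R, forall x, f x = c.

End Liouville.

(* Main.v *)
Require Import Defs.
From mathcomp Require Import all_boot all_order all_algebra.
From mathcomp Require Import boolp classical_sets cardinality reals.
From mathcomp Require Import ereal fsbigop functions numfun esum.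
From mathcomp Require Import normedtype sequences ring lra.

(** The measure is a mixture [mu = sum_k 2^-(k+1) nu_k] of finitely supported
    probabilities in the manner of Kaimanovich-Vershik and Rosenblatt. Each
    [nu_k] has an atom at the [k]-th element of the group, which makes [mu]
    non-degenerate, and is otherwise carried by translations [b |-> a b]. These
    are chosen, after [nu_0, ..., nu_(k-1)], so that the images of [nu_k] at
    any two points of a finite set [P_k] are [delta_k]-close in total
    variation; [P_k] consists of the points reached from the first [k] points
    of [A] in at most [n_k = k 2^k] steps taken in the supports of the
    previous levels.

    Let [f] be harmonic with [|f| <= M], and let [x], [y] be among the first
    [k] points. Run the random walk until the first step of level at least
    [k]. Within [n_k] steps such a step occurs except with probability
    [(1 - 2^-k)^(n_k) <= 1/(k+1)], and when it occurs the walks from [x] and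
    [y] are still in [P_k], so this step makes their laws nearly equal.
    Quantitatively,
    [|f x - f y| <= (1 - 2^-k)^(n_k) 2M + n_k delta_k M <= 3M/(k+1)]
    ([oscillation_bound]), and [f] is constant. This part
    ([contracting_liouville]) works for any action that is [contracting].

    That [A] acting on itself by translations is contracting is Reiter's
    condition ([reiter]): amenability gives finitely supported probabilities
    on [A] nearly invariant under finitely many given translations. If it
    failed, the finitely supported signed measures [z p - p] would stay away
    from 0, and the Hahn-Banach theorem ([convex_separation]) would provide
    bounded functions [phi_z] with
    [sum_z (phi_z (z a) - phi_z a) >= e > 0] for all [a], whereas an invariant
    mean vanishes on the left-hand side ([mean_le0]). *)

Set Implicit Arguments.
Unset Strict Implicit.
Unset Printing Implicit Defensive.

Import Order.TTheory GRing.Theory Num.Theory.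
Import numFieldNormedType.Exports.

Local Open Scope classical_set_scope.
Local Open Scope ring_scope.

(** * Finitely supported weights *)

Section Weights.
Variables (R : realType) (I : Type).
Implicit Types (s : seq (R * I)) (F : I -> R) (c : R).

(** A finitely supported signed measure on [I] is encoded as a list of pairs
    (mass, point); a point may occur several times, its masses adding up. *)
Definition nonneg_weights s : bool := all (fun p => 0 <= p.1) s.

(** Total mass. *)
Definition weight s : R := \sum_(p <- s) p.1.

(** Integral of [F] against the weights. *)
Definition expect s F : R := \sum_(p <- s) p.1 * F p.2.

Definition scale_weights c s : seq (R * I) := [seq (c * p.1, p.2) | p <- s].

Lemma scale_weights_ge0 c s : 0 <= c -> nonneg_weights s ->
  nonneg_weights (scale_weights c s).
Proof.
move=> c0 s0; rewrite /nonneg_weights all_map; apply: sub_all s0 => p /= p0.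
exact: mulr_ge0.
Qed.

Lemma weight_scale c s : weight (scale_weights c s) = c * weight s.
Proof. by rewrite /weight big_map mulr_sumr. Qed.

Lemma expect_scale c s F : expect (scale_weights c s) F = c * expect s F.
Proof.
by rewrite /expect big_map mulr_sumr; apply: eq_bigr => p _; rewrite /= mulrA.
Qed.

Lemma expect_ge0 s F : nonneg_weights s -> (forall i, 0 <= F i) ->
  0 <= expect s F.
Proof.
move=> s0 F0; rewrite /expect; elim: s s0 => [|p s IH]; first by rewrite big_nil.
by move=> /andP[p0 s0]; rewrite big_cons addr_ge0 ?mulr_ge0 ?IH.
Qed.

Lemma le_expect s F F' : nonneg_weights s -> (forall i, F i <= F' i) ->
  expect s F <= expect s F'.
Proof.
move=> s0 F0; rewrite /expect; elim: s s0 => [|p s IH]; first by rewrite !big_nil.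
by move=> /andP[p0 s0]; rewrite !big_cons lerD ?ler_wpM2l ?IH.
Qed.

Lemma expect_cst s c : expect s (fun=> c) = weight s * c.
Proof. by rewrite /expect -mulr_suml. Qed.

End Weights.

(** * Hahn-Banach theorem and separation of convex sets *)

(** [q] is sublinear on the subspace [D]; its values outside [D] are
    irrelevant. The inequality for scalars implies equality. *)
Definition sublinear_on (R : realType) (V : lmodType R) (D : set V)
    (q : V -> R) : Prop :=
  (forall u v, D u -> D v -> q (u + v) <= q u + q v) /\
  (forall c u, 0 <= c -> D u -> q (c *: u) <= c * q u).

Section HahnBanach.
Variables (R : realType) (V : lmodType R) (D : set V).
Hypotheses (D0 : D 0) (DD : forall u v, D u -> D v -> D (u + v))
  (DZ : forall c u, D u -> D (c *: u)).

Let DN u : D u -> D (- u).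
Proof. by rewrite -scaleN1r; exact: DZ. Qed.

Lemma sublinear0 q : sublinear_on D q -> q 0 = 0.
Proof.
move=> [qD qZ]; apply/eqP; rewrite eq_le; apply/andP; split.
  by have := qZ 0 0 (lexx 0) D0; rewrite scale0r mul0r.
by have := qD 0 0 D0 D0; rewrite addr0; lra.
Qed.

Lemma sublinearZ q c u : sublinear_on D q -> 0 <= c -> D u ->
  q (c *: u) = c * q u.
Proof.
move=> sq; rewrite le_eqVlt => /predU1P[<- _|c0 Du].
  by rewrite scale0r mul0r sublinear0.
have [qD qZ] := sq; apply/eqP; rewrite eq_le qZ ?(ltW c0)//=.
rewrite -ler_pdivlMl//; apply: le_trans (qZ c^-1 _ _ _).
- by rewrite scalerA mulVf ?gt_eqF// scale1r.
- by rewrite invr_ge0 ltW.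
- exact: DZ.
Qed.

Lemma sublinear_lbound q u : sublinear_on D q -> D u -> - q (- u) <= q u.
Proof.
move=> sq Du; have := sq.1 _ _ Du (DN Du); rewrite subrr sublinear0//; lra.
Qed.

(** The pointwise infimum of a chain of sublinear functions is sublinear. *)
Lemma sublinear_chain q (A : set (V -> R)) :
  A !=set0 ->
  (forall s, A s -> sublinear_on D s /\ (forall u, D u -> s u <= q u)) ->
  (forall s t, A s -> A t -> (forall u, D u -> s u <= t u) \/
                             (forall u, D u -> t u <= s u)) ->
  exists p, [/\ sublinear_on D p, (forall u, D u -> p u <= q u) &
    forall s, A s -> forall u, D u -> p u <= s u].
Proof.
move=> [s0 As0] Asq Atot; pose p u := inf [set s u | s in A].
have ple s u : A s -> D u -> p u <= s u.
  move=> As Du; apply: ge_inf; last by exists s.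
  exists (- q (- u)) => _ [t At <-]; have [st tq] := Asq _ At.
  by have := sublinear_lbound st Du; have := tq _ (DN Du); lra.
have lep u x : (forall s, A s -> x <= s u) -> x <= p u.
  move=> xA; apply: lb_le_inf; first by exists (s0 u), s0.
  by move=> _ [t At <-]; exact: xA.
exists p; split=> //; last first.
  by move=> s As u; exact: ple.
  by move=> u Du; apply: le_trans (ple _ _ As0 Du) _; exact: (Asq _ As0).2.
split=> [u v Du Dv|c u].
  rewrite -lerBlDr; apply: (@lep) => s As; rewrite lerBlDr -lerBlDl.
  apply: (@lep) => t At; rewrite lerBlDl.
  have [st|ts] := Atot _ _ As At.
    apply: le_trans (ple _ _ As (DD Du Dv)) _.
    by apply: le_trans ((Asq _ As).1.1 _ _ Du Dv) _; have := st _ Dv; lra.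
  apply: le_trans (ple _ _ At (DD Du Dv)) _.
  by apply: le_trans ((Asq _ At).1.1 _ _ Du Dv) _; have := ts _ Du; lra.
rewrite le_eqVlt => /predU1P[<- Du|c0 Du].
  rewrite scale0r mul0r; apply: le_trans (ple _ _ As0 D0) _.
  by rewrite sublinear0//; exact: (Asq _ As0).1.
rewrite mulrC -ler_pdivrMr//; apply: (@lep) => s As.
rewrite ler_pdivrMr// mulrC; apply: le_trans (ple _ _ As (DZ c Du)) _.
by apply: (Asq _ As).1.2 => //; exact: ltW.
Qed.

(** The function [r] is the infimum over [t >= 0] of the slopes
    [p (u + t v) - t p v]. If [p] is minimal then [r = p] on [D], and the last
    conclusion makes [p] superadditive. *)
Lemma sublinear_slope p v : sublinear_on D p -> D v ->
  exists r, [/\ sublinear_on D r, (forall u, D u -> r u <= p u) &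
    forall u, D u -> r u + p v <= p (u + v)].
Proof.
move=> sp Dv; have [pD pZ] := sp.
pose S u := [set p (u + t *: v) - t * p v | t in [set t | 0 <= t]].
pose r u := inf (S u).
have rle u t : 0 <= t -> D u -> r u <= p (u + t *: v) - t * p v.
  move=> t0 Du; apply: ge_inf; last by exists t.
  exists (- p (- u)) => _ [a /= a0 <-].
  have := pD _ _ (DD Du (DZ a Dv)) (DN Du).
  by rewrite addrAC subrr add0r sublinearZ//; lra.
have ler u x : (forall t, 0 <= t -> x <= p (u + t *: v) - t * p v) -> x <= r u.
  move=> xS; apply: lb_le_inf; first by exists (p (u + 0 *: v) - 0 * p v), 0 => /=.
  by move=> _ [t /= t0 <-]; exact: xS.
exists r; split; last 2 first.
- by move=> u Du; have := rle u 0 (lexx _) Du; rewrite scale0r addr0 mul0r subr0.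
- by move=> u Du; have := rle u 1 ler01 Du; rewrite scale1r mul1r; lra.
split=> [u w Du Dw|c u].
  rewrite -lerBlDr; apply: (@ler) => s s0; rewrite lerBlDr -lerBlDl.
  apply: (@ler) => t t0; rewrite lerBlDl.
  apply: le_trans (rle _ _ (addr_ge0 s0 t0) (DD Du Dw)) _.
  rewrite scalerDl addrACA.
  have := pD _ _ (DD Du (DZ s Dv)) (DD Dw (DZ t Dv)); lra.
rewrite le_eqVlt => /predU1P[<- Du|c0 Du].
  rewrite scale0r mul0r; apply: le_trans (rle _ 0 (lexx _) D0) _.
  by rewrite scale0r mul0r addr0 subr0 sublinear0.
rewrite mulrC -ler_pdivrMr//; apply: (@ler) => t t0.
rewrite ler_pdivrMr// mulrC.
apply: le_trans (rle _ (c * t) (mulr_ge0 (ltW c0) t0) (DZ c Du)) _.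
rewrite -scalerA -scalerDr sublinearZ ?(ltW c0)//; last by apply: DD => //; exact: DZ.
by rewrite mulrBr mulrA.
Qed.

(** Hahn-Banach: a minimal sublinear function below [q] is additive. *)
Theorem sublinear_additive_minorant q : sublinear_on D q ->
  exists l, [/\ forall u, D u -> l u <= q u,
    forall u v, D u -> D v -> l (u + v) = l u + l v &
    forall u, D u -> l (- u) = - l u].
Proof.
move=> sq.
pose T := {p : V -> R | sublinear_on D p /\ forall u, D u -> p u <= q u}.
pose le (s t : T) := `[< forall u, D u -> sval t u <= sval s u >].
have q0 : T by exists q.
have [||A totA|[p [sp pq]] pmin] := @ZL_preorder T q0 le.
- by move=> t; apply/asboolP.
- by move=> a b c /asboolP ba /asboolP ac; apply/asboolP => u Du;
    apply: le_trans (ac u Du) (ba u Du).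
- have [->|/set0P[s0 As0]] := eqVneq A set0; first by exists q0.
  have [|s [t At <-]|_ _ [s As <-] [t At <-]|p [sp pq pA]] :=
    @sublinear_chain q [set sval s | s in A].
  + by exists (sval s0), s0.
  + exact: (svalP t).
  + by case: (totA _ _ As At) => /asboolP; [right|left].
  exists (exist _ p (conj sp pq)) => s As; apply/asboolP => u Du /=.
  by apply: pA => //; exists s.
have padd u v : D u -> D v -> p (u + v) = p u + p v.
  move=> Du Dv; apply/eqP; rewrite eq_le sp.1//=.
  have [r [sr rp rv]] := sublinear_slope sp Dv.
  have rq w : D w -> r w <= q w.
    by move=> Dw; exact: le_trans (rp _ Dw) (pq _ Dw).
  have /asboolP/= pr := pmin (exist _ r (conj sr rq)) (asboolT rp).
  by apply: le_trans (rv _ Du); rewrite lerD2r; exact: pr.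
exists p; split => // u Du; have := padd _ _ Du (DN Du).
by rewrite subrr sublinear0//; lra.
Qed.


(** The linear combination of the vectors [v i] with the given weights. *)
Definition comb (I : Type) (v : I -> V) (s : seq (R * I)) : V :=
  \sum_(p <- s) p.1 *: v p.2.

(** If the nonnegative combinations of the [v i] satisfy
    [N (sum c_i v_i) >= e * sum c_i], then some functional of norm at most 1
    separates all the [v i] from 0. *)
Theorem convex_separation (N : V -> R) (I : Type) (v : I -> V) (e : R) :
  sublinear_on D N -> (forall u, D u -> N (- u) = N u) ->
  (forall i, D (v i)) ->
  (forall s : seq (R * I), nonneg_weights s -> e * weight s <= N (comb v s)) ->
  exists l : V -> R, [/\ forall u, D u -> `|l u| <= N u,
    forall u w, D u -> D w -> l (u + w) = l u + l w,
    forall u, D u -> l (- u) = - l u &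
    forall i, e <= l (v i)].
Proof.
move=> sN NN Dv eN.
have Dcomb s : D (comb v s).
  rewrite /comb; elim: s => [|p s IH]; first by rewrite big_nil.
  by rewrite big_cons; apply: DD => //; exact: DZ.
(* Minorizing [N] by the infimum of [N (u + sum c_i v_i) - e * sum c_i] keeps
   it sublinear and forces its value at [- v i] to be at most [- e]. *)
pose S u := [set N (u + comb v s) - e * weight s | s in @nonneg_weights R I].
pose q u := inf (S u).
have qle u s : nonneg_weights s -> D u -> q u <= N (u + comb v s) - e * weight s.
  move=> s0 Du; apply: ge_inf; last by exists s.
  exists (- N (- u)) => _ [a /= a0 <-].
  have := sN.1 _ _ (DD Du (Dcomb a)) (DN Du).
  by rewrite addrAC subrr add0r; have := eN _ a0; lra.
have leq u x :
    (forall s, nonneg_weights s -> x <= N (u + comb v s) - e * weight s) ->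
    x <= q u.
  move=> xS; apply: lb_le_inf.
    by exists (N (u + comb v [::]) - e * weight (@nil (R * I))), [::].
  by move=> _ [t /= t0 <-]; exact: xS.
have qN u : D u -> q u <= N u.
  move=> Du; have := qle u [::] isT Du.
  by rewrite /comb /weight !big_nil addr0 mulr0 subr0.
have sq : sublinear_on D q.
  split=> [u w Du Dw|c u].
    rewrite -lerBlDr; apply: (@leq) => s s0; rewrite lerBlDr -lerBlDl.
    apply: (@leq) => t t0; rewrite lerBlDl.
    have st0 : nonneg_weights (s ++ t).
      by rewrite /nonneg_weights all_cat -!/(nonneg_weights _) s0 t0.
    apply: le_trans (qle _ _ st0 (DD Du Dw)) _.
    rewrite /comb /weight !big_cat/= -!/(comb _ _) -!/(weight _) addrACA.
    have := sN.1 _ _ (DD Du (Dcomb s)) (DD Dw (Dcomb t)); lra.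
  rewrite le_eqVlt => /predU1P[<- Du|c0 Du].
    rewrite scale0r mul0r; apply: le_trans (qN _ D0) _.
    by rewrite sublinear0.
  rewrite mulrC -ler_pdivrMr//; apply: (@leq) => s s0.
  rewrite ler_pdivrMr// mulrC.
  have cs0 := scale_weights_ge0 (ltW c0) s0.
  apply: le_trans (qle _ _ cs0 (DZ c Du)) _.
  have -> : comb v (scale_weights c s) = c *: comb v s.
    rewrite /comb big_map scaler_sumr; apply: eq_bigr => p _.
    by rewrite scalerA.
  rewrite weight_scale -scalerDr sublinearZ ?(ltW c0)//; last by apply: DD.
  by rewrite mulrBr; lra.
have [l [lq lD lN]] := sublinear_additive_minorant sq.
exists l; split => // [u Du|i].
  rewrite ler_norml; apply/andP; split.
    by rewrite lerNl -lN// -NN//; apply: le_trans (lq _ (DN Du)) (qN _ (DN Du)).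
  exact: le_trans (lq _ Du) (qN _ Du).
have i0 : nonneg_weights [:: (1 : R, i)] by rewrite /nonneg_weights /= ler01.
have := qle _ _ i0 (DN (Dv i)); have := lq _ (DN (Dv i)).
rewrite /comb /weight !big_seq1 /= scale1r addNr mulr1 lN// sublinear0//; lra.
Qed.

End HahnBanach.

(** * Amenable groups satisfy the condition of Reiter *)

Section SupNorm.
Variables (R : realType) (X : Type).
Implicit Types f g : X -> R.

Definition supnorm f : R := sup [set `|f x| | x in [set: X]].

Lemma le_supnorm f x : bounded_real f -> `|f x| <= supnorm f.
Proof.
move=> [M fM]; apply: ub_le_sup; last by exists x.
by exists M => _ [y _ <-].
Qed.

Lemma supnorm_le f M : X -> (forall x, `|f x| <= M) -> supnorm f <= M.
Proof.
move=> x fM; apply: ge_sup; first by exists `|f x|, x.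
by move=> _ [y _ <-].
Qed.

Lemma bounded_realD f g : bounded_real f -> bounded_real g ->
  bounded_real (f + g).
Proof.
move=> [M fM] [N gN]; exists (M + N) => x.
exact: le_trans (ler_normD _ _) (lerD (fM x) (gN x)).
Qed.

Lemma bounded_realZ c f : bounded_real f -> bounded_real (c *: f).
Proof.
by move=> [M fM]; exists (`|c| * M) => x; rewrite normrM ler_wpM2l.
Qed.

Lemma bounded_real0 : bounded_real (0 : X -> R).
Proof. by exists 0 => x; rewrite normr0. Qed.

Lemma supnormN f : supnorm (- f) = supnorm f.
Proof.
rewrite /supnorm; congr sup; apply/seteqP; split=> _ [x _ <-]; exists x => //=.
  by rewrite normrN.
by rewrite normrN.
Qed.

Lemma supnorm_sublinear : X -> sublinear_on (@bounded_real R X) supnorm.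
Proof.
move=> x0; split=> [f g bf bg|c f c0 bf]; apply: supnorm_le => // x.
  by apply: le_trans (ler_normD _ _) _; rewrite lerD// le_supnorm.
by rewrite normrM ger0_norm// ler_wpM2l// le_supnorm.
Qed.

End SupNorm.

Section Mean.
Variables (R : realType) (A : groupType) (m : (A -> R) -> R).
Hypothesis m_mean : invariant_mean m.

Lemma mean0 : m (fun=> 0) = 0.
Proof.
have [lin _ _ _] := m_mean.
have b0 : bounded_real (fun _ : A => 0 : R) by exists 0 => x; rewrite normr0.
have := lin 1 _ _ b0 b0.
have -> : (fun _ : A => 1 * 0 + 0 : R) = fun=> 0 by apply/funext => x; lra.
lra.
Qed.

(** An invariant mean kills the functions [a |-> phi (z a) - phi a], hence also
    their finite sums, which are therefore not bounded below by a positive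
    constant. *)
Lemma mean_le0 (K : seq A) (phi : A -> A -> R) (e : R) :
  (forall z a, `|phi z a| <= 1) ->
  (forall a, e <= \sum_(z <- K) (phi z (z * a)%g - phi z a)) -> e <= 0.
Proof.
move=> phi1 ephi; have [lin pos m1 inv] := m_mean.
pose h K' a := \sum_(z <- K') (phi z (z * a)%g - phi z a).
have bphi z : bounded_real (phi z) by exists 1.
have bphi' z : bounded_real (fun a => phi z (z * a)%g) by exists 1.
have bh K' : bounded_real (h K') /\ m (h K') = 0.
  elim: K' => [|z K' [bK mK]].
    have -> : h [::] = fun=> 0 by apply/funext => a; rewrite /h big_nil.
    by split; [exists 0 => a; rewrite normr0|exact: mean0].
  have -> : h (z :: K') =
      (fun a => 1 * phi z (z * a)%g + ((-1) * phi z a + h K' a)).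
    by apply/funext => a; rewrite /h big_cons; lra.
  have b1 : bounded_real (fun a => (-1) * phi z a + h K' a).
    apply: bounded_realD bK; exact: bounded_realZ.
  split; first by apply: bounded_realD b1; exact: bounded_realZ.
  by rewrite !lin// inv// mK; lra.
have bone : bounded_real (fun _ : A => 1 : R) by exists 1 => a; rewrite normr1.
have := lin (- e) _ _ bone (bh K).1; rewrite m1 (bh K).2 => E.
have : 0 <= m (fun a => - e * 1 + h K a).
  apply: pos => [|a]; last by have := ephi a; rewrite -/(h K a); lra.
  by apply: bounded_realD (bh K).1; exact: (bounded_realZ _ bone).
by rewrite E; lra.
Qed.

End Mean.

(** Reiter's condition: the probability [s] is nearly invariant in total
    variation under left translation by the elements of [K]; total variation
    is expressed by duality, through the bounded functions [F]. *)
Theorem reiter (R : realType) (A : groupType) (K : seq A) (e : R) :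
  amenable R A -> 0 < e ->
  exists s : seq (R * A), [/\ nonneg_weights s, weight s = 1 &
    forall z F M, z \in K -> (forall a, `|F a| <= M) ->
      `|expect s (fun a => F (z * a)%g) - expect s F| <= e * M].
Proof.
move=> [m m_mean] e0.
(* Families of signed measures indexed by [K] are represented through their
   action on the unit ball [Phi] of families of bounded functions: [v a] stands
   for the family (delta_(z a) - delta_a)_z, and the supremum norm over [Phi] is
   its total variation norm. *)
pose Phi := {phi : A -> A -> R | forall z a, `|phi z a| <= 1}.
pose ev z a : Phi -> R := fun phi => sval phi z a.
pose v a : Phi -> R := \sum_(z <- undup K) (ev z (z * a)%g - ev z a).
have phi0 : Phi by exists (fun _ _ => 0) => z a; rewrite normr0.
have ev1 z a phi : `|ev z a phi| <= 1 by exact: (svalP phi).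
have bev z a : bounded_real (ev z a) by exists 1.
have bevB z a b : bounded_real (ev z a - ev z b).
  by apply: bounded_realD => //; rewrite -scaleN1r; exact: bounded_realZ.
have bsum (L : seq A) a : bounded_real (\sum_(z <- L) (ev z (z * a)%g - ev z a)).
  elim: L => [|z L IH]; first by rewrite big_nil; exact: bounded_real0.
  by rewrite big_cons; exact: bounded_realD.
have sN := @supnorm_sublinear R Phi phi0.
have [|noS] := pselect (exists s : seq (R * A), nonneg_weights s /\
    supnorm (comb v s) < e * weight s); last first.
  have [||s s0|l [lN lD lM le]] := @convex_separation R (Phi -> R)
    (@bounded_real R Phi) (@bounded_real0 _ _) (@bounded_realD _ _)
    (@bounded_realZ _ _) (@supnorm R Phi) A v e sN.
  - by move=> u _; exact: supnormN.
  - by move=> i; exact: bsum.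
  - by rewrite leNgt; apply/negP => ?; apply: noS; exists s.
  pose phi z a := l (ev z a).
  suff: e <= 0 by lra.
  apply: (mean_le0 m_mean (K := undup K) (phi := phi)) => [z a|a].
    by apply: le_trans (lN _ (bev z a)) _; exact: supnorm_le.
  apply: le_trans (le a) _; rewrite le_eqVlt; apply/orP; left; apply/eqP.
  rewrite /v; elim: (undup K) => [|z L IH].
    rewrite !big_nil; have := lM _ (@bounded_real0 R Phi); rewrite oppr0; lra.
  rewrite !big_cons lD//; first by rewrite IH lD// ?lM// -scaleN1r; exact: bounded_realZ.
move=> [s [s0 sN']].
have bcomb : bounded_real (comb v s).
  rewrite /comb; elim: (s) => [|p t IH].
    by rewrite big_nil; exact: bounded_real0.
  rewrite big_cons; apply: bounded_realD => //; apply: bounded_realZ.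
  exact: bsum.
have N0 : 0 <= supnorm (comb v s).
  exact: le_trans (normr_ge0 _) (le_supnorm phi0 bcomb).
have W0 : 0 < weight s by rewrite -(pmulr_rgt0 _ e0); exact: le_lt_trans sN'.
pose w := weight s; exists (scale_weights w^-1 s); split.
- by apply: scale_weights_ge0 => //; rewrite invr_ge0 ltW.
- by rewrite weight_scale mulVf// gt_eqF.
move=> z F M zK FM.
have M0 : 0 <= M := le_trans (normr_ge0 _) (FM 1%g).
have [M00|Mneq] := eqVneq M 0.
  have F0 a : F a = 0 by apply/eqP; rewrite -normr_le0 -M00.
  by rewrite /expect !big1 ?subr0 ?normr0 ?M00 ?mulr0// => p _; rewrite F0 mulr0.
have {M0 Mneq} M0 : 0 < M by rewrite lt_neqAle eq_sym Mneq.
have phiP w' a : `|(w' == z)%:R * (F a / M)| <= 1.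
  rewrite !normrM normfV [`|M|]gtr0_norm//.
  case: (w' == z); rewrite ?normr1 ?normr0 ?mul0r// mul1r.
  by rewrite ler_pdivrMr// mul1r.
(* Testing [v] against [F / M] placed in the component [z] isolates the
   translation by [z]; [undup] makes this component occur once. *)
pose phi : Phi := exist _ (fun w' a => (w' == z)%:R * (F a / M)) phiP.
have cE : comb v s phi = (expect s (fun a => F (z * a)%g) - expect s F) / M.
  rewrite /comb /expect -sumrB mulr_suml.
  rewrite (_ : (\sum_(p <- s) p.1 *: v p.2) phi =
    \sum_(p <- s) p.1 * v p.2 phi); last first.
    by elim: (s) => [|p t IH]; rewrite ?big_nil// !big_cons -IH.
  apply: eq_bigr => p _; rewrite -mulrBr -mulrA; congr (_ * _).
  rewrite /v (_ : (\sum_(z <- _) _) phi =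
    \sum_(y <- undup K) (y == z)%:R * ((F (y * p.2)%g - F p.2) / M)); last first.
    elim: (undup K) => [|y t IH]; rewrite ?big_nil// !big_cons -IH.
    by rewrite mulrBl mulrBr.
  rewrite (bigD1_seq z) ?mem_undup ?undup_uniq//= eqxx mul1r big1 ?addr0//.
  by move=> y /negPf ->; rewrite mul0r.
rewrite !expect_scale -mulrBr normrM normfV (gtr0_norm W0) ler_pdivrMl//.
rewrite mulrA (mulrC w) -ler_pdivrMr//.
have -> : `|expect s (fun a => F (z * a)%g) - expect s F| / M = `|comb v s phi|.
  by rewrite cE normrM normfV (gtr0_norm M0).
exact: le_trans (le_supnorm phi bcomb) (ltW sN').
Qed.

(** * Sums of nonnegative families *)

Section Esum.
Variable R : realType.
Local Open Scope ereal_scope.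

Lemma esumZl (T : choiceType) (c : R) (a : T -> \bar R) :
  (0 <= c)%R -> (forall i, 0 <= a i) ->
  \esum_(i in [set: T]) (c%:E * a i) = c%:E * \esum_(i in [set: T]) a i.
Proof.
move=> c0 a0.
have aux (d : R) (b : T -> \bar R) : (0 <= d)%R -> (forall i, 0 <= b i) ->
    \esum_(i in [set: T]) (d%:E * b i) <= d%:E * \esum_(i in [set: T]) b i.
  move=> d0 b0; apply: ge_ereal_sup => _ [X XT <-].
  rewrite -ge0_mule_fsumr//; apply: lee_wpmul2l; first by rewrite lee_fin.
  by apply: esum_ge; exists X.
apply/eqP; rewrite eq_le aux//=.
move: (c0); rewrite le0r => /predU1P[->|{}c0].
  by rewrite mul0e esum_ge0// => i _; rewrite mul0e.
rewrite -lee_pdivlMl//.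
have {1}-> : a = fun i => (c^-1)%:E * (c%:E * a i).
  by apply/funext => i; rewrite muleA -EFinM mulVf ?mul1e// gt_eqF.
apply: aux; first by rewrite invr_ge0 ltW.
by move=> i; rewrite mule_ge0// lee_fin ltW.
Qed.

Lemma esum_exchange (S T : choiceType) (a : S -> T -> \bar R) :
  (forall i j, 0 <= a i j) ->
  \esum_(i in [set: S]) \esum_(j in [set: T]) a i j =
  \esum_(j in [set: T]) \esum_(i in [set: S]) a i j.
Proof.
move=> a0; rewrite !esum_esum//.
rewrite (@reindex_esum R (T * S)%type (S * T)%type
  ([set: T] `*`` fun=> [set: S]) ([set: S] `*`` fun=> [set: T])
  (fun p => (p.2, p.1)))//.
split=> [p//|p q _ _ [] pq1 pq2|[s t] _].
  by case: p q pq1 pq2 => [? ?] [? ?] /= -> ->.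
by exists (t, s).
Qed.

Lemma esum_single (T : choiceType) (x : T) (c : T -> R) : (0 <= c x)%R ->
  \esum_(h in [set: T]) ((x == h)%:R * c h)%:E = (c x)%:E.
Proof.
move=> cx; rewrite -[RHS](@esum_set1 R T x (fun h => (c h)%:E))//.
rewrite [RHS]esum_mkcond; apply: eq_esum => h _.
have -> : (h \in [set x]) = (x == h).
  by apply/idP/eqP => [/set_mem ->//|->]; exact: mem_set.
by case: eqVneq => _; rewrite ?mul1r ?mul0r.
Qed.

Lemma cvg_series_esum (b : nat -> R) (S : R) : (forall k, 0 <= b k)%R ->
  \esum_(k in [set: nat]) (b k)%:E = S%:E ->
  (fun n => (\sum_(0 <= k < n) b k)%R) @ \oo --> S.
Proof.
move=> b0 bS; have b0E k : 0 <= (b k)%:E by rewrite lee_fin.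
have := @is_cvg_nneseries R (fun k => (b k)%:E) xpredT 0 (fun n _ _ => b0E n).
move=> /cvg_ex[l bl]; have := cvg_lim (@ereal_hausdorff R) bl.
rewrite nneseries_esumT// bS => Sl; move: bl; rewrite -Sl => /fine_cvgP[_].
rewrite (_ : (fun n => _) = fine \o (fun n => \sum_(0 <= k < n) (b k)%:E))//.
by apply/funext => n /=; rewrite sumEFin.
Qed.

(** The mass 2^-(k+1) given to the level [k] of a mixture. *)
Definition half_pow (k : nat) : R := 1 / (2 ^ (k + 1))%:R.

Lemma half_pow_ge0 k : (0 <= half_pow k)%R.
Proof. by rewrite /half_pow divr_ge0. Qed.

Lemma half_pow_gt0 k : (0 < half_pow k)%R.
Proof. by rewrite /half_pow divr_gt0// ltr0n expn_gt0. Qed.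

Lemma sum_half_pow n : (\sum_(0 <= k < n) half_pow k = 1 - 2 ^- n)%R.
Proof.
elim: n => [|n IH]; first by rewrite big_nil expr0 invr1 subrr.
rewrite big_nat_recr//= IH /half_pow natrX addn1 exprS.
have : (2 ^+ n != 0 :> R)%R by rewrite expf_neq0.
by move=> ?; field.
Qed.

Lemma esum_half_pow : \esum_(k in [set: nat]) (half_pow k)%:E = 1.
Proof.
rewrite -nneseries_esumT; last by move=> k; rewrite lee_fin half_pow_ge0.
have := cvg_lim (@ereal_hausdorff R) (@cvg_geometric_eseries_half R 1 0).
by rewrite expr0 divr1 => E; exact: E.
Qed.

End Esum.

(** * Mixtures of a sequence of probability measures *)

Section Mixture.
Variables (R : realType) (H : choiceType) (nu : nat -> seq (R * H)).
Hypotheses (nu_ge0 : forall k, nonneg_weights (nu k))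
  (nu_weight : forall k, weight (nu k) = 1).

(** The measure giving mass 2^-(k+1) to each of the probabilities [nu k]. *)
Definition mixture (h : H) : R :=
  fine (\esum_(k in [set: nat])
    (half_pow R k * expect (nu k) (fun x => (x == h)%:R))%:E).

Lemma mixtureE h : (mixture h)%:E = (\esum_(k in [set: nat])
    (half_pow R k * expect (nu k) (fun x => (x == h)%:R))%:E)%E.
Proof.
rewrite fineK// ge0_fin_numE; last first.
  apply: esum_ge0 => k _.
  by rewrite lee_fin mulr_ge0 ?half_pow_ge0 ?expect_ge0.
apply: (@le_lt_trans _ _ 1%E); last exact: ltry.
rewrite -(esum_half_pow R); apply: le_esum => k _.
rewrite lee_fin ler_piMr ?half_pow_ge0//.
have : expect (nu k) (fun=> 1) = 1 by rewrite expect_cst nu_weight mulr1.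
by move=> {2}<-; apply: le_expect => // x; case: (x == h).
Qed.

Lemma mixture_ge0 h : 0 <= mixture h.
Proof.
rewrite -lee_fin mixtureE; apply: esum_ge0 => k _.
by rewrite lee_fin mulr_ge0 ?half_pow_ge0 ?expect_ge0.
Qed.

Lemma esum_mixture (phi : H -> R) : (forall h, 0 <= phi h) ->
  (\esum_(h in [set: H]) (mixture h * phi h)%:E =
   \esum_(k in [set: nat]) (half_pow R k * expect (nu k) phi)%:E)%E.
Proof.
move=> phi0.
transitivity (\esum_(h in [set: H]) \esum_(k in [set: nat])
    (phi h * (half_pow R k * expect (nu k) (fun x => (x == h)%:R)))%:E)%E.
  apply: eq_esum => h _; rewrite mulrC EFinM mixtureE -esumZl//.
  by move=> k; rewrite lee_fin mulr_ge0 ?half_pow_ge0 ?expect_ge0.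
rewrite esum_exchange; last first.
  by move=> h k; rewrite lee_fin !mulr_ge0 ?half_pow_ge0 ?expect_ge0.
apply: eq_esum => k _; rewrite EFinM.
transitivity (\esum_(h in [set: H]) (half_pow R k)%:E *
  (\sum_(p <- nu k) ((p.2 == h)%:R * (p.1 * phi h))%:E))%E.
  apply: eq_esum => h _; rewrite sumEFin -EFinM mulrCA; congr (_ * _)%:E.
  by rewrite /expect mulr_sumr; apply: eq_bigr => p _; ring.
have nu0 p : p \in nu k -> 0 <= p.1 by move=> pnu; exact: (allP (nu_ge0 k)).
rewrite esumZl ?half_pow_ge0//; last first.
  move=> h; rewrite big_seq_cond sume_ge0// => p; rewrite andbT => pnu.
  by rewrite lee_fin !mulr_ge0// nu0.
congr (_ * _)%E; rewrite /expect -sumEFin.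
rewrite [RHS]big_seq.
under eq_esum do rewrite big_seq.
rewrite esum_sum; last by move=> h p _ pnu; rewrite lee_fin !mulr_ge0// nu0.
by apply: eq_bigr => p pnu; rewrite esum_single// mulr_ge0// nu0.
Qed.

Lemma mixture_prob : prob_mass mixture.
Proof.
split; first exact: mixture_ge0.
transitivity (\esum_(h in [set: H]) (mixture h * 1)%:E)%E.
  by apply: eq_esum => h _; rewrite mulr1.
rewrite (@esum_mixture (fun=> 1))// -(esum_half_pow R).
by apply: eq_esum => k _; rewrite expect_cst nu_weight !mulr1.
Qed.

Lemma mixture_gt0 k c h : (c, h) \in nu k -> 0 < c -> 0 < mixture h.
Proof.
move=> ch c0; rewrite -lte_fin mixtureE.
apply: (@lt_le_trans _ _ (half_pow R k * c)%:E).
  by rewrite lte_fin mulr_gt0// half_pow_gt0.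
apply: esum_ge; exists [set k]; first by split=> //; exact: finite_set1.
rewrite fsbig_set1 lee_fin ler_wpM2l ?half_pow_ge0//.
have /perm_to_rem pm := ch; rewrite /expect (perm_big _ pm) big_cons /= eqxx mulr1.
rewrite lerDl big_seq sumr_ge0// => p /mem_rem pnu.
by rewrite mulr_ge0//; exact: (allP (nu_ge0 k)).
Qed.

End Mixture.

(** * Harmonic functions of a mixture *)

Section HarmonicMixture.
Variables (R : realType) (H : groupType) (X : choiceType) (act : grpAction H X).
Variable nu : nat -> seq (R * H).
Hypotheses (nu_ge0 : forall k, nonneg_weights (nu k))
  (nu_weight : forall k, weight (nu k) = 1).

(** The Markov operator of the finitely supported measure [s]. *)
Definition average (s : seq (R * H)) (f : X -> R) (x : X) : R :=
  expect s (fun h => f (act h x)).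

Lemma esum_transition_mixture (g : X -> R) x : (forall y, 0 <= g y) ->
  (\esum_(y in [set: X]) ((g y)%:E * transition act (mixture nu) x y) =
   \esum_(k in [set: nat]) (half_pow R k * average (nu k) g x)%:E)%E.
Proof.
move=> g0.
have mu0 := mixture_ge0 nu_ge0 nu_weight.
rewrite -(esum_mixture nu_ge0 nu_weight (phi := fun h => g (act h x)))//.
transitivity (\esum_(y in [set: X]) \esum_(h in [set: H])
    (g y * ((act h x == y)%:R * mixture nu h))%:E)%E.
  apply: eq_esum => y _; rewrite -esumZl//.
  by move=> h; rewrite lee_fin mulr_ge0.
rewrite esum_exchange; last by move=> y h; rewrite lee_fin !mulr_ge0.
apply: eq_esum => h _.
rewrite -(@esum_single R X (act h x) (fun y => mixture nu h * g y)) ?mulr_ge0//.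
by apply: eq_esum => y _; congr EFin; ring.
Qed.

Lemma harmonic_mixture_series (f : X -> R) x : bounded_real f ->
  mu_harmonic act (mixture nu) f ->
  (fun n => \sum_(0 <= k < n) half_pow R k * average (nu k) f x) @ \oo --> f x.
Proof.
move=> [M fM] /(_ x)[_ fx].
have maxe0M (c : R) (t : \bar R) :
    (0 <= t -> maxe (c%:E * t) 0 = (Num.max c 0)%:E * t)%E.
  move=> t0; case: (leP 0 c) => c0; first by rewrite max_l// mule_ge0.
  by rewrite mul0e max_r// mule_le0_ge0// lee_fin ltW.
pose fp y := Num.max (f y) 0; pose fn y := Num.max (- f y) 0.
have fp0 y : 0 <= fp y by rewrite le_max lexx orbT.
have fn0 y : 0 <= fn y by rewrite le_max lexx orbT.
have t0 y : (0 <= transition act (mixture nu) x y)%E.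
  apply: esum_ge0 => h _; rewrite lee_fin mulr_ge0//.
  exact: (mixture_ge0 nu_ge0 nu_weight).
have fpM y : fp y <= M.
  by have := fM y; rewrite ler_norml /fp ge_max => /andP[? ?]; apply/andP; lra.
have fnM y : fn y <= M.
  by have := fM y; rewrite ler_norml /fn ge_max => /andP[? ?]; apply/andP; lra.
have cv g : (forall y, 0 <= g y) -> (forall y, g y <= M) -> exists2 S : R,
    (\esum_(y in [set: X]) ((g y)%:E * transition act (mixture nu) x y) = S%:E)%E &
    (fun n => \sum_(0 <= k < n) half_pow R k * average (nu k) g x) @ \oo --> S.
  move=> g0 gM; rewrite esum_transition_mixture//.
  have a0 k : 0 <= half_pow R k * average (nu k) g x.
    by rewrite mulr_ge0 ?half_pow_ge0//; exact: expect_ge0.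
  pose E := (\esum_(k in [set: nat]) (half_pow R k * average (nu k) g x)%:E)%E.
  have Efin : E \is a fin_num.
    rewrite ge0_fin_numE; last by apply: esum_ge0 => k _; rewrite lee_fin.
    apply: (@le_lt_trans _ _ M%:E); last exact: ltry.
    have M0 : 0 <= M := le_trans (g0 x) (gM x).
    rewrite -[leRHS]mule1 -(esum_half_pow R) -esumZl//; last first.
      by move=> k; rewrite lee_fin half_pow_ge0.
    apply: le_esum => k _; rewrite lee_fin mulrC ler_wpM2r ?half_pow_ge0//.
    have <- : expect (nu k) (fun=> M) = M by rewrite expect_cst nu_weight mul1r.
    exact: le_expect.
  exists (fine E); first by rewrite fineK.
  by apply: cvg_series_esum => //; rewrite fineK.
have [Sp Ep cp] := cv fp fp0 fpM; have [Sn En cn] := cv fn fn0 fnM.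
have fxS : f x = Sp - Sn.
  apply: EFin_inj; rewrite fx EFinB -Ep -En; congr (_ - _)%E.
    apply: eq_esum => y _; rewrite funeposE maxe0M// /fp; exact: t0.
  by apply: eq_esum => y _; rewrite funenegE -mulNe -EFinN maxe0M// /fn; exact: t0.
rewrite fxS.
rewrite (_ : (fun n => _) = (fun n =>
  (\sum_(0 <= k < n) half_pow R k * average (nu k) fp x) -
  (\sum_(0 <= k < n) half_pow R k * average (nu k) fn x))); first exact: cvgB.
apply/funext => n; rewrite -sumrB; apply: eq_bigr => k _; rewrite -mulrBr.
congr (_ * _); rewrite /average /expect -sumrB; apply: eq_bigr => p _.
rewrite -mulrBr; congr (_ * _); rewrite /fp /fn.
by case: (leP 0 (f (act p.2 x))) => h; rewrite /Order.max; case: ltP; case: ltP; lra.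
Qed.

(** The levels beyond [k] contribute at most [e] to [f x - f y] as soon as
    they nearly agree at [x] and [y]. *)
Lemma harmonic_mixture_head (f : X -> R) k x y e : bounded_real f ->
  mu_harmonic act (mixture nu) f -> 0 <= e ->
  (forall j, (k <= j)%N -> `|average (nu j) f x - average (nu j) f y| <= e) ->
  `|(f x - f y) - \sum_(0 <= j < k) half_pow R j *
      (average (nu j) f x - average (nu j) f y)| <= e.
Proof.
move=> bf hf e0 ae.
pose a j := half_pow R j * (average (nu j) f x - average (nu j) f y).
have ca : (fun n => \sum_(0 <= j < n) a j) @ \oo --> f x - f y.
  rewrite (_ : (fun n => _) = (fun n =>
    (\sum_(0 <= k < n) half_pow R k * average (nu k) f x) -
  (\sum_(0 <= k < n) half_pow R k * average (nu k) f y))).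
    by apply: cvgB; exact: harmonic_mixture_series.
  by apply/funext => n; rewrite -sumrB; apply: eq_bigr => j _; rewrite -mulrBr.
have cb : (fun n => `|\sum_(0 <= j < n) a j - \sum_(0 <= j < k) a j|) @ \oo -->
    `|(f x - f y) - \sum_(0 <= j < k) a j|.
  by apply: cvg_norm; apply: cvgB => //; exact: cvg_cst.
apply: cvgr_to_le cb _; near=> n.
have kn : (k <= n)%N by near: n; exists k.
rewrite (big_cat_nat (leq0n k) kn)/= addrAC subrr add0r.
apply: le_trans (ler_norm_sum _ _ _) _.
apply: (@le_trans _ _ (\sum_(k <= j < n) half_pow R j * e)).
  rewrite big_nat [leRHS]big_nat; apply: ler_sum => j /andP[kj _].
  by rewrite normrM ger0_norm ?half_pow_ge0// ler_wpM2l ?half_pow_ge0// ae.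
rewrite -mulr_suml ler_piMl//.
have := sum_half_pow R n; rewrite (big_cat_nat (leq0n k) kn)/= => E.
have : 0 <= \sum_(0 <= j < k) half_pow R j.
  by rewrite sumr_ge0// => j _; exact: half_pow_ge0.
have : 0 <= (2 ^- n : R) by rewrite invr_ge0 exprn_ge0.
lra.
Unshelve. all: by end_near. Qed.

End HarmonicMixture.

Lemma countable_enumeration (T : Type) (t0 : T) : countable [set: T] ->
  exists e : nat -> T, forall x, exists n, e n = x.
Proof.
move=> /countable_injP[f finj].
exists (fun n => if pselect (exists x, f x = n) is left p then sval (cid p) else t0).
move=> x; exists (f x); case: pselect => [p|[]]; last by exists x.
by apply: finj; rewrite ?inE//; exact: (svalP (cid p)).
Qed.

(** Bernoulli's inequality gives [(1 + u)^n >= 1 + n u] with [u = 2^-k] and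
    [n = k 2^k], and [(1 - u) (1 + u) <= 1]. *)
Lemma bernoulli_half_pow (R : realType) k :
  (1 - 2 ^- k) ^+ (k * 2 ^ k) <= (k.+1%:R)^-1 :> R.
Proof.
set u : R := 2 ^- k.
have u0 : 0 < u by rewrite invr_gt0 exprn_gt0.
have u1 : u <= 1 by rewrite invf_le1 ?exprn_gt0// exprn_ege1// ler1n.
have bern n : 1 + n%:R * u <= (1 + u) ^+ n.
  elim: n => [|n IH]; first by rewrite mul0r addr0 expr0.
  rewrite exprS -natr1.
  have := ler_wpM2l (addr_ge0 ler01 (ltW u0)) IH.
  have : 0 <= n%:R * u * u by rewrite !mulr_ge0// ltW.
  lra.
have := bern (k * 2 ^ k)%N; rewrite natrM natrX -mulrA mulfV ?expf_neq0// mulr1.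
rewrite addrC natr1 => kb.
rewrite -[leRHS]mul1r ler_pdivlMr ?ltr0n//.
apply: le_trans (ler_wpM2l _ kb) _; first by rewrite exprn_ge0// subr_ge0.
rewrite -exprMn exprn_ile1//; last nra.
by rewrite mulr_ge0//; nra.
Qed.

(** * Contracting actions have a Liouville measure *)

Section Contracting.
Variables (R : realType) (H : groupType) (X : choiceType) (act : grpAction H X).

(** Any finite set of points can be mapped, by a finitely supported random
    element of the group, to random points that are arbitrarily close to each
    other in total variation. *)
Definition contracting : Prop := forall (xs : seq X) (e : R), 0 < e ->
  exists s : seq (R * H), [/\ nonneg_weights s, weight s = 1 &
    forall x y F M, x \in xs -> y \in xs -> (forall z, `|F z| <= M) ->
      `|average act s F x - average act s F y| <= e * M].

(** The points [h_i ... h_1 x] with [i <= j], [x] in [B] and all [h_i] in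
    [S]. *)
Definition ball_from (S : seq H) (B : seq X) (j : nat) : seq X :=
  iter j (fun C => C ++ [seq act h x | h <- S, x <- C]) B.

Lemma ball_from_step S B j h x : h \in S -> x \in ball_from S B j ->
  act h x \in ball_from S B j.+1.
Proof. by move=> hS xB; rewrite /= mem_cat allpairs_f ?orbT. Qed.

Lemma ball_from_leq S B i j : (i <= j)%N ->
  {subset ball_from S B i <= ball_from S B j}.
Proof.
move=> /subnK <- x; elim: (j - i)%N => // n IH xB.
by rewrite addSn /= mem_cat IH.
Qed.

Lemma ball_fromS (S S' : seq H) (B B' : seq X) j :
  {subset S <= S'} -> {subset B <= B'} ->
  {subset ball_from S B j <= ball_from S' B' j}.
Proof.
move=> SS BB; elim: j => //= j IH x; rewrite !mem_cat => /orP[/IH -> //|].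
move=> /allpairsP[[h y] /= [hS yB ->]].
by rewrite allpairs_f ?orbT//; [exact: SS|exact: IH].
Qed.

Hypotheses (countH : countable [set: H]) (countX : countable [set: X])
  (act_contracting : contracting).

(** With [radius k] steps, the probability that all of them have level less
    than [k] is at most 1 / (k + 1), by [bernoulli_half_pow]. The error
    [delta k] remains negligible when repeated [radius k] times. *)
Definition radius (k : nat) : nat := (k * 2 ^ k)%N.
Definition delta (k : nat) : R := (((radius k).+1 * k.+1)%N%:R)^-1.

Lemma leq_radius i j : (i <= j)%N -> (radius i <= radius j)%N.
Proof. by move=> ij; rewrite leq_mul// leq_pexp2l. Qed.

Lemma delta_gt0 k : 0 < delta k.
Proof. by rewrite invr_gt0 ltr0n. Qed.

Lemma delta_le1 k : delta k <= 1.
Proof. by rewrite invf_le1 ?ltr0n// ler1n. Qed.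

Lemma le_delta i j : (i <= j)%N -> delta j <= delta i.
Proof.
move=> ij; rewrite lef_pV2 ?posrE ?ltr0n// ler_nat leq_mul// ltnS.
exact: leq_radius.
Qed.

Lemma radius_delta k : (radius k)%:R * delta k <= (k.+1%:R)^-1.
Proof.
rewrite /delta natrM invfM mulrA ler_piMl ?invr_ge0//.
by rewrite ler_pdivrMr ?ltr0n// mul1r ler_nat.
Qed.

Section Construction.
Variables (eH : nat -> H) (eX : nat -> X).
Hypotheses (eH_surj : forall h, exists n, eH n = h)
  (eX_surj : forall x, exists n, eX n = x).

(** The points at distance at most [j] from the first [k] points of [X]. *)
Definition points (k : nat) (S : seq H) (j : nat) : seq X :=
  ball_from S [seq eX i | i <- iota 0 k] j.

(** The requirements on the measure [s] of level [k], where [S] contains the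
    supports of all previous levels. *)
Definition good_level (k : nat) (S : seq H) (s : seq (R * H)) : Prop :=
  [/\ nonneg_weights s, weight s = 1, exists2 c, 0 < c & (c, eH k) \in s &
    forall x y F M, x \in points k S (radius k) -> y \in points k S (radius k) ->
      (forall z, `|F z| <= M) ->
      `|average act s F x - average act s F y| <= delta k * M].

Lemma good_level_exists k S : exists s, good_level k S s.
Proof.
set d := delta k; have d0 : 0 < d := delta_gt0 k; have d1 : d <= 1 := delta_le1 k.
have d2 : 0 < d / 2 by lra.
have [s [s0 s1 sF]] := act_contracting (points k S (radius k)) d2.
(* Mixing in the atom [eH k] with mass [d / 4] costs [d / 2 * M]. *)
exists ((d / 4, eH k) :: scale_weights (1 - d / 4) s); split.
- rewrite /nonneg_weights /=; apply/andP; split; first by lra.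
  by apply: scale_weights_ge0 => //; lra.
- rewrite /weight big_cons -/(weight _) weight_scale s1 /=; lra.
- by exists (d / 4); [lra|rewrite mem_head].
move=> x y F M xP yP FM.
have avE z : average act ((d / 4, eH k) :: scale_weights (1 - d / 4) s) F z =
    d / 4 * F (act (eH k) z) + (1 - d / 4) * average act s F z.
  rewrite /average /expect big_cons; congr (_ + _).
  exact: (expect_scale _ _ (fun h => F (act h z))).
have := sF x y F M xP yP FM; rewrite !avE -/d.
have := FM (act (eH k) x); have := FM (act (eH k) y); rewrite !ler_norml.
have M0 : 0 <= M := le_trans (normr_ge0 _) (FM x).
move: (F _) (F _) (average _ _ _ _) (average _ _ _ _) => a b p q.
move=> /andP[a1 a2] /andP[b1 b2] /andP[c1 c2].
have t0 : 0 <= 1 - d / 4 by lra.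
have dM : 0 <= d * (d * M) by rewrite !mulr_ge0// ltW.
have := ler_wpM2l (ltW d0) a1; have := ler_wpM2l (ltW d0) a2.
have := ler_wpM2l (ltW d0) b1; have := ler_wpM2l (ltW d0) b2.
have := ler_wpM2l t0 c1; have := ler_wpM2l t0 c2.
move=> *; apply/andP; split; lra.
Qed.

Definition next_level k S : seq (R * H) := sval (cid (good_level_exists k S)).

(** The union of the supports of the levels less than [k]. *)
Fixpoint past_support (k : nat) : seq H :=
  if k is j.+1 then past_support j ++ unzip2 (next_level j (past_support j))
  else [::].

Definition level (k : nat) : seq (R * H) := next_level k (past_support k).

Lemma levelP k : good_level k (past_support k) (level k).
Proof. exact: (svalP (cid (good_level_exists _ _))). Qed.

Lemma past_support_leq i j : (i <= j)%N ->
  {subset past_support i <= past_support j}.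
Proof.
move=> /subnK <- x; elim: (j - i)%N => // n IH xB.
by rewrite addSn /= mem_cat IH.
Qed.

Lemma level_past_support j k p : (j < k)%N -> p \in level j ->
  p.2 \in past_support k.
Proof.
move=> jk pj; apply: (past_support_leq jk).
by rewrite /= mem_cat; apply/orP; right; exact: map_f.
Qed.

Lemma points_leq i j : (i <= j)%N ->
  {subset points i (past_support i) (radius i) <=
          points j (past_support j) (radius j)}.
Proof.
move=> ij x /(ball_from_leq (leq_radius ij)).
apply: ball_fromS; first exact: past_support_leq.
move=> _ /mapP[n nI ->]; apply: map_f; move: nI; rewrite !mem_iota !add0n.
by move=> /leq_trans; exact.
Qed.

Let level_ge0 k : nonneg_weights (level k). Proof. by case: (levelP k). Qed.
Let level_weight k : weight (level k) = 1. Proof. by case: (levelP k). Qed.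

Lemma mixture_level_gt0 h : 0 < mixture level h.
Proof.
have [k <-] := eH_surj h; have [_ _ [c c0 ck] _] := levelP k.
exact: (mixture_gt0 level_ge0 level_weight ck).
Qed.

(** Splitting off the levels beyond [k] at one step costs [delta k * M]; the
    remaining levels have total mass [1 - 2^-k] and move the points one step
    further in the ball. *)
Lemma oscillation_bound (f : X -> R) M k i x y :
  (forall z, `|f z| <= M) -> mu_harmonic act (mixture level) f ->
  (i <= radius k)%N ->
  x \in points k (past_support k) (radius k - i) ->
  y \in points k (past_support k) (radius k - i) ->
  `|f x - f y| <= (1 - 2 ^- k) ^+ i * (2 * M) + i%:R * (delta k * M).
Proof.
move=> fM hf; have M0 : 0 <= M := le_trans (normr_ge0 _) (fM x).
elim: i x y => [|i IH] x y ik xP yP.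
  rewrite expr0 mul1r mul0r addr0; apply: le_trans (ler_normB _ _) _.
  by have := fM x; have := fM y; lra.
set s : R := 1 - 2 ^- k.
set D := s ^+ i * (2 * M) + i%:R * (delta k * M) in IH.
have dM0 : 0 <= delta k * M by rewrite mulr_ge0// ltW// delta_gt0.
have s0 : 0 <= s by rewrite subr_ge0 invf_le1 ?exprn_gt0// exprn_ege1// ler1n.
have s1 : s <= 1 by rewrite lerBlDr lerDl invr_ge0 exprn_ge0.
have head : `|(f x - f y) - \sum_(0 <= j < k) half_pow R j *
    (average act (level j) f x - average act (level j) f y)| <= delta k * M.
  apply: (harmonic_mixture_head level_ge0 level_weight) => //; first by exists M.
  move=> j kj; apply: le_trans (ler_wpM2r M0 (le_delta kj)).
  have [_ _ _ lev] := levelP j; apply: lev => //; apply: (points_leq kj).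
    exact: (ball_from_leq (leq_subr _ _)) xP.
  exact: (ball_from_leq (leq_subr _ _)) yP.
have tail : `|\sum_(0 <= j < k) half_pow R j *
    (average act (level j) f x - average act (level j) f y)| <= s * D.
  apply: le_trans (ler_norm_sum _ _ _) _.
  rewrite /s -sum_half_pow mulr_suml big_nat [leRHS]big_nat.
  apply: ler_sum => j /andP[_ jk].
  rewrite normrM ger0_norm ?half_pow_ge0// ler_wpM2l ?half_pow_ge0//.
  rewrite /average /expect -sumrB.
  apply: le_trans (ler_norm_sum _ _ _) _.
  rewrite -[leRHS]mul1r -(level_weight j) /weight mulr_suml.
  rewrite big_seq [leRHS]big_seq; apply: ler_sum => p pj.
  have p0 : 0 <= p.1 by exact: (allP (level_ge0 j)).
  rewrite -mulrBr normrM ger0_norm// ler_wpM2l//.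
  have pS := level_past_support jk pj.
  by apply: IH; [exact: ltnW|rewrite -subnSK//; exact: ball_from_step..].
have Di : s * D <= s ^+ i.+1 * (2 * M) + i%:R * (delta k * M).
  rewrite /D mulrDr mulrA -exprS lerD2l ler_piMl// mulr_ge0//.
rewrite -natr1 mulrDl mul1r.
have := ler_normD ((f x - f y) - \sum_(0 <= j < k) half_pow R j *
    (average act (level j) f x - average act (level j) f y))
  (\sum_(0 <= j < k) half_pow R j *
    (average act (level j) f x - average act (level j) f y)).
rewrite subrK; lra.
Qed.

Lemma mixture_level_liouville : mu_liouville act (mixture level).
Proof.
move=> f [M fM] hf; have M0 : 0 <= M := le_trans (normr_ge0 _) (fM (eX 0)).
suff fxy x y : f x = f y by exists (f (eX 0)) => x; exact: fxy.
have [i ix] := eX_surj x; have [j jy] := eX_surj y.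
have bound k : (i < k)%N -> (j < k)%N -> `|f x - f y| <= 3 * M / k.+1%:R.
  move=> ik jk.
  have mem n z : (n < k)%N -> eX n = z ->
      z \in points k (past_support k) (radius k - radius k).
    by move=> nk <-; rewrite subnn /points /=; apply: map_f; rewrite mem_iota.
  apply: le_trans (oscillation_bound fM hf (leqnn _)
    (mem _ _ ik ix) (mem _ _ jk jy)) _.
  have := ler_wpM2r (mulr_ge0 (ler0n R 2) M0) (bernoulli_half_pow R k).
  have := ler_wpM2r M0 (radius_delta k).
  rewrite -/(radius k).
  move: (_ ^+ _ : R) (k.+1%:R^-1 : R) ((radius k)%:R : R) => a q r; lra.
apply/eqP; rewrite -subr_eq0 -normr_eq0 eq_le normr_ge0 andbT leNgt.
apply/negP => d0.
set d := `|f x - f y| in d0 bound.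
pose n := Num.Def.archi_bound (3 * M / d).
have nP : 3 * M / d < n%:R.
  by apply: archi_boundP; rewrite divr_ge0 ?mulr_ge0// ltW.
pose k := (n + i + j).+1.
have ik : (i < k)%N by rewrite ltnS -addnA addnCA leq_addr.
have jk : (j < k)%N by rewrite ltnS leq_addl.
have := bound k ik jk; rewrite ler_pdivlMr ?ltr0n// leNgt => /negP; apply.
rewrite [ltRHS]mulrC -ltr_pdivrMr//; apply: lt_le_trans nP _.
by rewrite ler_nat; do 2!apply: leqW; rewrite -addnA leq_addr.
Qed.

End Construction.

(** The point [x0] only witnesses that [X] is inhabited. *)
Theorem contracting_liouville (x0 : X) : exists mu : H -> R,
  [/\ prob_mass mu, nondegenerate_mass mu & mu_liouville act mu].
Proof.
have [eH eHP] := countable_enumeration (1%g : H) countH.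
have [eX eXP] := countable_enumeration x0 countX.
exists (mixture (level eH eX)); split.
- by apply: mixture_prob => k; have [] := levelP eH eX k.
- rewrite /nondegenerate_mass /generates.
  rewrite (_ : [set h | _] = [set: H]); last first.
    by apply/seteqP; split=> h //= _; exact: mixture_level_gt0.
  by apply/seteqP; split=> h // _ K [_]; exact.
- exact: mixture_level_liouville.
Qed.

End Contracting.

(** * The action of the semi-direct product *)

(** Translations already contract. Reiter's condition is for left
    translations while [A] is to be translated on the right by the starting
    point, hence the inverses. *)
Lemma semidirect_contracting (R : realType) (G A : groupType)
    (al : autAction G A) :
  amenable R A -> contracting R (semidirect_action al).
Proof.
move=> amA xs e e0; have e2 : 0 < e / 2 by lra.
have [s [s0 s1 sF]] := reiter [seq x^-1%g | x <- xs] amA e2.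
pose s' : seq (R * semidirect al) := [seq (p.1, (1%g, p.2^-1%g)) | p <- s].
exists s'; split.
- by rewrite /nonneg_weights all_map.
- by rewrite /weight big_map.
move=> x y F M xP yP FM.
pose F' b := F b^-1%g.
have avE z : average (semidirect_action al) s' F z =
    expect s (fun a => F' (z^-1 * a)%g).
  rewrite /average /expect big_map; apply: eq_bigr => p _.
  by rewrite /F' /= /sd_act /= gact1 invgM invgK.
have F'M b : `|F' b| <= M by exact: FM.
rewrite !avE.
have := sF _ F' M (map_f _ xP) F'M; have := sF _ F' M (map_f _ yP) F'M.
have := ler_distD (expect s F') (expect s (fun a => F' (x^-1 * a)%g))
  (expect s (fun a => F' (y^-1 * a)%g)).
rewrite (distrC (expect s F')); lra.
Qed.

Theorem lemma4 (R : realType) (G A : groupType) (al : autAction G A)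
    (hG : countable [set: G]) (hA : countable [set: A])
    (amA : amenable R A) :
  exists mu : semidirect al -> R,
    [/\ prob_mass mu, nondegenerate_mass mu
      & mu_liouville (semidirect_action al) mu].
Proof.
apply: contracting_liouville => //; last exact: 1%g.
  by rewrite -setXTT; exact: countableX.
exact: semidirect_contracting.
Qed.
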